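(* Let $\mathcal{T}=(T,C)$ be a triangulation with $n$ boundary vertices and let $\sigma=(z_1,\dots,z_n)$ be an $n$-gon shape. Then $X_{\sigma}(\mathcal{T})$ is an irreducible algebraic variety over $\mathbb{C}$.
   Context: Let $T$ be a finite oriented 2-dimensional simplicial complex whose underlying space is homeomorphic to a closed disk, with vertex set $\mathrm{Vert}(T)$. Its boundary vertices $P_1,\dots,P_n$, listed in cyclic order, are called corners; $\partial T$ denotes the set of corners; the other vertices are interior vertices. For a set $S$ of triangles of $T$, $\mathrm{Vert}(S)$ is the set of vertices of triangles of $S$; $S$ is contiguous if the graph $S^*$, with one vertex per triangle of $S$ and an edge for each pair of triangles of $S$ sharing an edge, is connected. A condition is a set $C\subset \mathrm{Vert}(T)$ such that $C=\mathrm{Vert}(S)$ for some contiguous set of triangles $S$ and $|C\cap\partial T|\le 2$; $C=\emptyset$ is allowed. A triangulation is a pair $\mathcal{T}=(T,C)$ with $T$ a finite oriented 2-dimensional simplicial complex whose underlying space is homeomorphic to a closed disk and $C$ a (possibly empty) condition. $X(\mathcal{T})$ is the set of all maps $\rho:\mathrm{Vert}(T)\to\mathbb{C}^2$ such that there is an affine line in $\mathbb{C}^2$ containing $\rho(v)$ for every $v\in C$. For $n\ge 3$, an $n$-gon shape is an ordered $n$-tuple $(z_1,\dots,z_n)$ of points of $\mathbb{C}^2$, no three of which are collinear. For an $n$-gon shape $\sigma$, $$X_\sigma(\mathcal{T})=\{\rho\in X(\mathcal{T}) : \text{there is a (not necessarily invertible) affine map } \phi:\mathbb{C}^2\to\mathbb{C}^2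 \text{ with } \rho(P_i)=\phi(z_i)\ \text{for all } i\}.$$ It is regarded as a subset of the affine space of all maps $\mathrm{Vert}(T)\to\mathbb{C}^2$. *)

(* Defs.v *)
(* The field of complex numbers is R[i] for an arbitrary R : realType. *)
From HB Require Import structures.
From mathcomp Require Import all_boot all_order all_algebra.

Set Implicit Arguments.
Unset Strict Implicit.
Unset Printing Implicit Defensive.

Import Order.TTheory GRing.Theory Num.Theory.

(* Every v : V is a vertex, so that V plays the role of Vert(T). *)
Record simplicial_complex (V : finType) := SimplicialComplex {
  simplices : {set {set V}};
  simplices_vertex : forall v : V, [set v] \in simplices;
  simplices_neq0 : set0 \notin simplices;
  simplices_face : forall s t : {set V},
    s \in simplices -> t \subset s -> t != set0 -> t \in simplices
}.

Section Combinatorics.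
Variables (V : finType) (K : simplicial_complex V).

Definition complex_dim : nat := (\max_(s in simplices K) #|s|).-1.

Definition triangles : {set {set V}} := [set t in simplices K | #|t| == 3].

Definition edges : {set {set V}} := [set e in simplices K | #|e| == 2].

(* The boundary complex of a triangulated surface is spanned by the edges that
   lie in exactly one triangle. *)
Definition boundary_edges : {set {set V}} :=
  [set e in edges | #|[set t in triangles | e \subset t]| == 1].

Definition boundary_vertices : {set V} := cover boundary_edges.

(* [o a b c] means that (a, b, c) is a positively ordered triangle.  A triangle
   has exactly two cyclic orders, one of which is positive; two distinct
   triangles with a common edge induce opposite directions on it. *)
Definition is_orientation (o : V -> V -> V -> bool) : Prop :=
  [/\ forall a b c, o a b c -> [set a; b; c] \in triangles,
      forall a b c, o a b c = o b c a,
      forall a b c, [set a; b; c] \in triangles -> o b a c = ~~ o a b c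
    & forall a b c d, o a b c -> o a b d -> c = d].

(* Connectedness of the dual graph on S.  It holds vacuously for S = set0,
   whose vertex set is the empty condition. *)
Definition contiguous (S : {set {set V}}) : Prop :=
  forall s t, s \in S -> t \in S ->
    connect (fun a b : {set V} => [&& a \in S, b \in S & a :&: b \in edges])
      s t.

Definition is_condition (C : {set V}) : Prop :=
  (exists S : {set {set V}},
     [/\ S \subset triangles, contiguous S & C = cover S])
  /\ #|C :&: boundary_vertices| <= 2.

(* P lists the boundary vertices, without repetition, in the order in which
   they occur around the boundary circle (in either direction). *)
Definition is_boundary_listing (n : nat) (P : 'I_n -> V) : Prop :=
  [/\ injective P,
      forall v, (v \in boundary_vertices) <-> exists i, P i = v
    & forall i, [set P i; P (ordS i)] \in boundary_edges].

End Combinatorics.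

From mathcomp Require Import all_classical all_reals all_analysis.
From mathcomp Require Import complex.
From mathcomp.multinomials Require Import -(notations) mpoly.
Import numFieldNormedType.Exports.

Local Open Scope classical_set_scope.
Local Open Scope ring_scope.

Definition homeomorphic (X Y : topologicalType) (A : set X) (B : set Y) : Prop :=
  exists (f : X -> Y) (g : Y -> X),
    [/\ {within A, continuous f}, {within B, continuous g},
        (forall x, A x -> B (f x) /\ g (f x) = x)
      & (forall y, B y -> A (g y) /\ f (g y) = y)].

(* Barycentric coordinates. *)
Definition realization (R : realType) (V : finType) (K : simplicial_complex V) :
    set {ptws V -> R} :=
  [set x | [/\ forall v, 0 <= x v, \sum_v x v = 1
             & finset (fun v => x v != 0) \in simplices K]].

Definition closed_disk (R : realType) : set (R * R) :=
  [set p | p.1 ^+ 2 + p.2 ^+ 2 <= 1].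

Record triangulation (R : realType) (V : finType) (n : nat) := Triangulation {
  tri_complex : simplicial_complex V;
  tri_orientation : V -> V -> V -> bool;
  tri_corner : 'I_n -> V;
  tri_condition : {set V};
  tri_dim : complex_dim tri_complex = 2%N;
  tri_disk : homeomorphic (@realization R V tri_complex) (@closed_disk R);
  tri_oriented : is_orientation tri_complex tri_orientation;
  tri_corners : is_boundary_listing tri_complex tri_corner;
  tri_cond : is_condition tri_complex tri_condition
}.

Section Plane.
Variable F : fieldType.

Definition affine_line (L : set 'rV[F]_2) : Prop :=
  exists p u : 'rV[F]_2, u != 0 /\ L = [set p + t *: u | t in setT].

Definition collinear (A : set 'rV[F]_2) : Prop :=
  exists L, affine_line L /\ A `<=` L.

Definition affine_map (phi : 'rV[F]_2 -> 'rV[F]_2) : Prop :=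
  exists (A : 'M[F]_2) (b : 'rV[F]_2), forall x, phi x = x *m A + b.

Definition ngon_shape (n : nat) (z : 'I_n -> 'rV[F]_2) : Prop :=
  (3 <= n)%N /\
  forall i j k, i != j -> j != k -> i != k ->
    ~ collinear [set x | x = z i \/ x = z j \/ x = z k].

(* The affine space of all maps V -> F^2; its coordinates are indexed by
   V * 'I_2. *)
Variable V : finType.

Definition coordinates (rho : V -> 'rV[F]_2) : 'I_#|{: V * 'I_2}| -> F :=
  fun k => rho (enum_val k).1 0 (enum_val k).2.

Definition zero_locus (S : set (mpoly #|{: V * 'I_2}| F)) :
    set (V -> 'rV[F]_2) :=
  [set rho | forall p, S p -> meval (coordinates rho) p = 0].

Definition algebraic_set (X : set (V -> 'rV[F]_2)) : Prop :=
  exists S, X = zero_locus S.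

Definition irreducible_variety (X : set (V -> 'rV[F]_2)) : Prop :=
  [/\ algebraic_set X, X !=set0
    & forall A B, algebraic_set A -> algebraic_set B ->
        X = A `|` B -> X = A \/ X = B].

End Plane.

Section DrawingSpaces.
Variables (R : realType) (V : finType) (n : nat) (T : triangulation R V n).

Definition drawings : set (V -> 'rV[R[i]]_2) :=
  [set rho | collinear (rho @` [set` tri_condition T])].

Definition shaped_drawings (z : 'I_n -> 'rV[R[i]]_2) :
    set (V -> 'rV[R[i]]_2) :=
  [set rho | drawings rho /\
     exists phi, affine_map phi /\ forall i, rho (tri_corner T i) = phi (z i)].

End DrawingSpaces.

(* Main.v *)
(* A set any two of whose points x, y are joined by a polynomial curve g inside
   the set is irreducible: if p(x) and q(y) are nonzero, then the univariate
   polynomials p(g(s)) and q(g(s)) are nonzero, so p q does not vanish on the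
   set.  For the shaped drawings such a curve is the segment from x to y
   corrected by a quadratic term that keeps the points of the condition C on a
   moving line; since C has at most two corners, and these may be moved
   independently by affine maps, the correction extends compatibly with the
   shape. *)
Require Import Defs.
From mathcomp Require Import all_boot all_order all_algebra.
From mathcomp Require Import all_classical all_reals all_analysis.
From mathcomp Require Import complex.
From mathcomp Require Import ring.
From mathcomp.multinomials Require Import -(notations) mpoly.
Import Order.TTheory GRing.Theory Num.Theory.
Local Open Scope classical_set_scope.
Local Open Scope ring_scope.

Set Implicit Arguments.
Unset Strict Implicit.
Unset Printing Implicit Defensive.

(** * Collinearity and affine maps in the plane, expressed by determinants *)

Section PlaneGeometry.
Variable F : fieldType.
Implicit Types (x y a b c p u : 'rV[F]_2) (A : set 'rV[F]_2).

Lemma rV2P x y : x 0 0 = y 0 0 -> x 0 1 = y 0 1 -> x = y.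
Proof.
move=> e0 e1; apply/rowP => j.
case: (unliftP 0 j) => [k ->|->//]; rewrite ord1 (_ : lift _ _ = 1) //.
exact/val_inj.
Qed.

(** The determinant of [b - a] and [c - a], that is, twice the signed area of the triangle; it is
    polynomial in the coordinates. *)
Definition area a b c : F :=
  (b 0 0 - a 0 0) * (c 0 1 - a 0 1) - (b 0 1 - a 0 1) * (c 0 0 - a 0 0).

Lemma area_line p u (r s t : F) :
  area (p + r *: u) (p + s *: u) (p + t *: u) = 0.
Proof. by rewrite /area !mxE; ring. Qed.

Lemma area_eq0_line a b c : a != b -> area a b c = 0 ->
  exists t, c = a + t *: (b - a).
Proof.
move=> neq_ab abc0.
have [e0|n0] := eqVneq (b 0 0 - a 0 0) 0; last first.
  exists ((c 0 0 - a 0 0) / (b 0 0 - a 0 0)); apply: rV2P; rewrite !mxE.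
    by rewrite divfK // addrC subrK.
  apply: (mulfI n0); rewrite mulrDr mulrA [X in _ + X * _]mulrC divfK //.
  by rewrite -[LHS]subr0 -[in LHS]abc0 /area; ring.
have n1 : b 0 1 - a 0 1 != 0.
  apply: contra neq_ab => /eqP e1; apply/eqP/rV2P; apply/esym/subr0_eq => //.
exists ((c 0 1 - a 0 1) / (b 0 1 - a 0 1)); apply: rV2P; rewrite !mxE.
  move: abc0; rewrite /area e0 mul0r sub0r => /eqP.
  rewrite oppr_eq0 mulf_eq0 (negPf n1) /= subr_eq0 => /eqP ->.
  by rewrite mulr0 addr0.
by rewrite divfK // addrC subrK.
Qed.

(** Two distinct points of [A] span a line, and zero area puts every other point of [A] on it. If
    [A] has at most one point, a line with direction [const_mx 1] serves. *)
Lemma collinearP A :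
  collinear A <-> (forall a b c, A a -> A b -> A c -> area a b c = 0).
Proof.
split=> [[L [[p [u [_ ->]]] AL]] a b c /AL[r _ <-] /AL[s _ <-] /AL[t _ <-]|A0].
  exact: area_line.
have [[a [b [Aa Ab neq_ab]]]|single] :=
    pselect (exists a b, [/\ A a, A b & a != b]).
  exists [set a + t *: (b - a) | t in setT]; split.
    by exists a, (b - a); rewrite subr_eq0 eq_sym.
  by move=> c Ac; have [t ->] := area_eq0_line neq_ab (A0 _ _ _ Aa Ab Ac); exists t.
have [[a Aa]|empty] := pselect (exists a, A a); last first.
  exists [set 0 + t *: const_mx 1 | t in setT]; split.
    exists 0, (const_mx 1); split=> //; apply/eqP => /rowP/(_ 0).
    by rewrite !mxE => /eqP; rewrite oner_eq0.
  by move=> a Aa; case: empty; exists a.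
exists [set a + t *: const_mx 1 | t in setT]; split.
  exists a, (const_mx 1); split=> //; apply/eqP => /rowP/(_ 0).
  by rewrite !mxE => /eqP; rewrite oner_eq0.
move=> b Ab; exists 0 => //; rewrite scale0r addr0.
by have [//|neq_ab] := eqVneq a b; case: single; exists a, b.
Qed.

Lemma noncollinear_area a b c :
  ~ collinear [set x | x = a \/ x = b \/ x = c] -> area a b c != 0.
Proof.
move=> ncol; apply/eqP => abc0; apply: ncol; apply/collinearP.
(* [area] is alternating: on a triple drawn from the three points it is 0 or, up to sign,
   [area a b c]. Both signs are at hand for the case analysis. *)
have cba0 : - area a b c = 0 by rewrite abc0 oppr0.
by move=> ? ? ? [->|[->|->]] [->|[->|->]] [->|[->|->]];
   first [rewrite /area; ring | rewrite -[RHS]abc0 /area; ring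
         | rewrite -[RHS]cba0 /area; ring].
Qed.

Definition affine_form (l : 'rV[F]_2 -> F) : Prop :=
  exists k0 k1 k, forall x, l x = x 0 0 * k0 + x 0 1 * k1 + k.

Lemma affine_map_scale (l : 'rV[F]_2 -> F) u :
  affine_form l -> affine_map (fun x => l x *: u).
Proof.
move=> [k0 [k1 [k lE]]].
exists (\matrix_(i, j) ((if i == 0 then k0 else k1) * u 0 j)), (k *: u) => x.
by apply: rV2P; rewrite lE !mxE big_ord_recl big_ord1 !mxE /=
  (_ : lift _ _ = 1) ?mulrDl ?mulrA //; apply/val_inj.
Qed.

Lemma affine_mapD (f g : 'rV[F]_2 -> 'rV[F]_2) :
  affine_map f -> affine_map g -> affine_map (fun x => f x + g x).
Proof.
move=> [A [b fE]] [B [c gE]]; exists (A + B), (b + c) => x.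
by rewrite fE gE mulmxDr addrACA.
Qed.

Lemma affine_mapZ (k : F) (f : 'rV[F]_2 -> 'rV[F]_2) :
  affine_map f -> affine_map (fun x => k *: f x).
Proof.
move=> [A [b fE]]; exists (k *: A), (k *: b) => x.
by rewrite fE scalerDr scalemxAr.
Qed.

Lemma affine_map_cst u : affine_map (fun=> u).
Proof. by exists 0, u => x; rewrite mulmx0 add0r. Qed.

Lemma affine_form_interp a b (r s : F) : a != b ->
  exists l, [/\ affine_form l, l a = r & l b = s].
Proof.
move=> neq_ab; have [e0|n0] := eqVneq (b 0 0 - a 0 0) 0; last first.
  exists (fun x => r + (x 0 0 - a 0 0) / (b 0 0 - a 0 0) * (s - r)); split.
  - exists ((s - r) / (b 0 0 - a 0 0)), 0,
      (r - a 0 0 / (b 0 0 - a 0 0) * (s - r)) => x; field.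
    exact: n0.
  - by rewrite subrr mul0r mul0r addr0.
  - by rewrite divff // mul1r addrC subrK.
have n1 : b 0 1 - a 0 1 != 0.
  apply: contra neq_ab => /eqP e1; apply/eqP/rV2P; apply/esym/subr0_eq => //.
exists (fun x => r + (x 0 1 - a 0 1) / (b 0 1 - a 0 1) * (s - r)); split.
- exists 0, ((s - r) / (b 0 1 - a 0 1)),
    (r - a 0 1 / (b 0 1 - a 0 1) * (s - r)) => x; field.
  exact: n1.
- by rewrite subrr mul0r mul0r addr0.
- by rewrite divff // mul1r addrC subrK.
Qed.

(* Cramer's rule for the barycentric coordinates of [x] in the frame
   [a, b, c]. *)
Lemma affine_map_area (f : 'rV[F]_2 -> 'rV[F]_2) a b c x : affine_map f ->
  area a b c *: (f x - f a) =
    area a x c *: (f b - f a) + area a b x *: (f c - f a).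
Proof.
move=> [A [d fE]]; rewrite !fE.
by apply: rV2P; rewrite /area !mxE !big_ord_recl !big_ord0 (_ : lift _ _ = 1);
   [ring|apply/val_inj|ring|apply/val_inj].
Qed.

(** An affine map is determined by its values on a nondegenerate frame. The existence of [phi] thus
    becomes a system of linear equations in [w], with coefficients depending only on [z]. *)
Lemma affine_map_frame (n : nat) (z w : 'I_n -> 'rV[F]_2) (i j k : 'I_n) :
  area (z i) (z j) (z k) != 0 ->
  (exists phi, affine_map phi /\ forall m, w m = phi (z m)) <->
  forall m, area (z i) (z j) (z k) *: (w m - w i) =
    area (z i) (z m) (z k) *: (w j - w i)
      + area (z i) (z j) (z m) *: (w k - w i).
Proof.
move=> D0; split=> [[phi [phiA wE]] m|wE].
  by rewrite !wE; exact: affine_map_area.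
set D := area _ _ _ in D0 wE.
(* Cramer's formula solved for the value at [x]; it is affine because each area is an affine form in
   [x]. *)
exists (fun x => w i + D^-1 *: (area (z i) x (z k) *: (w j - w i)
  + area (z i) (z j) x *: (w k - w i))); split.
  apply: affine_mapD; first exact: affine_map_cst.
  apply/affine_mapZ/affine_mapD; apply: affine_map_scale; rewrite /area.
    exists (z k 0 1 - z i 0 1), (z i 0 0 - z k 0 0),
      (z i 0 1 * (z k 0 0 - z i 0 0) - z i 0 0 * (z k 0 1 - z i 0 1)) => x.
    by ring.
  exists (z i 0 1 - z j 0 1), (z j 0 0 - z i 0 0),
    (z i 0 0 * (z j 0 1 - z i 0 1) - z i 0 1 * (z j 0 0 - z i 0 0)) => x.
  by ring.
by move=> m; rewrite -wE scalerA mulVf // scale1r addrC subrK.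
Qed.

End PlaneGeometry.

(** * Zariski-closed sets and irreducibility *)

Section Zariski.
Variables (F : numFieldType) (V : finType).
Implicit Types (rho : V -> 'rV[F]_2) (X : set (V -> 'rV[F]_2)).

Definition coordX (v : V) (j : 'I_2) : mpoly #|{: V * 'I_2}| F :=
  mpolyX F (mnm1 (enum_rank (v, j))).

Lemma meval_coordX rho v j : meval (coordinates rho) (coordX v j) = rho v 0 j.
Proof. by rewrite mevalXU /coordinates enum_rankK. Qed.

(** The defining family is the whole vanishing ideal of [X], so a separating polynomial may be
    chosen for each outside point separately. *)
Lemma algebraic_set_separation X :
  (forall rho, ~ X rho -> exists p,
     (forall tau, X tau -> meval (coordinates tau) p = 0) /\
     meval (coordinates rho) p != 0) -> algebraic_set X.
Proof.
move=> sep.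
exists [set p | forall tau, X tau -> meval (coordinates tau) p = 0].
apply/seteqP; split=> [rho Xrho p /(_ _ Xrho)//|rho Zrho].
apply: contrapT => /sep[p [pX /eqP]]; apply; exact: Zrho.
Qed.

Lemma horner_mmap m (p : mpoly m F) (g : 'I_m -> {poly F}) s :
  (mmap polyC g p).[s] = meval (fun k => (g k).[s]) p.
Proof.
rewrite /meval /mmap horner_sum; apply: eq_bigr => e _.
rewrite hornerM hornerC /mmap1 horner_prod; congr (_ * _).
by apply: eq_bigr => k _; rewrite horner_exp.
Qed.

Lemma poly_eq0_horner (p : {poly F}) : (forall s, p.[s] = 0) -> p = 0.
Proof.
(* In characteristic 0 the integers below [size p] are distinct, which gives more roots than the
   degree allows. *)
move=> p0; apply: (roots_geq_poly_eq0 (rs := [seq k%:R | k <- iota 0 (size p)])).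
- by apply/allP => s _; rewrite /root p0.
- by rewrite map_inj_uniq ?iota_uniq // => a b /eqP; rewrite eqr_nat => /eqP.
- by rewrite size_map size_iota.
Qed.

Lemma irreducible_curves X : algebraic_set X -> X !=set0 ->
  (forall x y, X x -> X y -> exists g : V -> 'I_2 -> {poly F},
     [/\ forall s, X (fun v => \row_j (g v j).[s]),
         forall v j, (g v j).[0] = x v 0 j
       & forall v j, (g v j).[1] = y v 0 j]) ->
  irreducible_variety X.
Proof.
move=> Xalg X0 curves; split=> // A B [S AE] [S' BE] XE.
have AX : A `<=` X by rewrite XE => x; left.
have BX : B `<=` X by rewrite XE => x; right.
apply: contrapT => /not_orP[nXA nXB].
(* A proper closed subset of [X] misses a point of [X], where one of its equations fails. *)
have sep Y Q : Y `<=` X -> X <> Y -> Y = zero_locus Q ->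
    exists x p, [/\ X x, Q p & meval (coordinates x) p != 0].
  move=> YX XY YE; apply: contrapT => nsep; apply: XY.
  apply/seteqP; split=> // x Xx; rewrite YE => p Qp.
  by apply/eqP/negPn/negP => px; apply: nsep; exists x, p.
have [x [p [Xx Sp px]]] := sep _ _ AX nXA AE.
have [y [q [Xy Sq qy]]] := sep _ _ BX nXB BE.
have [g [gX g0 g1]] := curves x y Xx Xy.
pose G (k : 'I_#|{: V * 'I_2}|) := g (enum_val k).1 (enum_val k).2.
have Gs s r : (mmap polyC G r).[s] =
    meval (coordinates (fun v => \row_j (g v j).[s])) r.
  by rewrite horner_mmap; apply: meval_eq => k; rewrite /coordinates mxE.
(* [mmap polyC G] restricts a polynomial to the curve. Each point of the curve lies in [A] or in
   [B], so one factor vanishes at every parameter. *)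
have /eqP : mmap polyC G p * mmap polyC G q = 0.
  apply: poly_eq0_horner => s; rewrite hornerM !Gs.
  have := gX s; rewrite XE => -[|]; rewrite ?AE ?BE => Z.
    by rewrite (Z p Sp) mul0r.
  by rewrite (Z q Sq) mulr0.
have end_coord s (w : V -> 'rV[F]_2) : (forall v j, (g v j).[s] = w v 0 j) ->
    (fun v => \row_j (g v j).[s]) = w.
  by move=> gw; apply/funext => v; apply/rowP => j; rewrite mxE gw.
rewrite mulf_eq0 => /orP[] /eqP pq0.
  by move: px; rewrite -(end_coord 0 x g0) -Gs pq0 horner0 eqxx.
by move: qy; rewrite -(end_coord 1 y g1) -Gs pq0 horner0 eqxx.
Qed.

End Zariski.

(** At most two corners lie in [C], and an affine form takes any prescribed values at two distinct
    points. *)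
Lemma affine_form_ext (F : fieldType) (V : finType) (n : nat)
    (z : 'I_n -> 'rV[F]_2) (P : 'I_n -> V) (C B : {set V}) (t : V -> F) :
  injective P -> injective z -> (forall i, P i \in B) -> (#|C :&: B| <= 2)%N ->
  exists l, affine_form l /\ forall i, P i \in C -> t (P i) = l (z i).
Proof.
move=> Pinj zinj PB C2.
have [[i [j [iC jC neq_ij]]]|single] :=
    pselect (exists i j, [/\ P i \in C, P j \in C & i != j]).
  have neq_z : z i != z j by rewrite (inj_eq zinj).
  have [l [lA li lj]] := affine_form_interp (t (P i)) (t (P j)) neq_z.
  exists l; split=> // k kC.
  have [->//|neq_ki] := eqVneq k i; have [->//|neq_kj] := eqVneq k j.
  (* A third corner in [C] would contradict the cardinality bound. *)
  have : ([set P i; P j; P k] \subset C :&: B)%SET.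
    by apply/fintype.subsetP => v; rewrite !inE -orbA => /or3P[] /eqP ->; apply/andP.
  move/subset_leq_card/leq_trans/(_ C2).
  rewrite finset.setUC cardsU1 cards2 !inE !(inj_eq Pinj).
  by rewrite (negPf neq_ki) (negPf neq_kj) neq_ij.
have [[i iC]|none] := pselect (exists i, P i \in C); last first.
  exists (fun=> 0); split; first by exists 0, 0, 0 => x; ring.
  by move=> i iC; case: none; exists i.
exists (fun=> t (P i)); split; first by exists 0, 0, (t (P i)) => x; ring.
move=> k kC; have [->//|neq_ki] := eqVneq k i.
by case: single; exists k, i.
Qed.

(** * The space of shaped drawings: closedness, a point, and joining curves *)

Section ShapedDrawings.
Variables (R : realType) (V : finType) (n : nat) (T : triangulation R V n).
Variable z : 'I_n -> 'rV[R[i]]_2.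
Hypothesis shape_z : ngon_shape z.

Let C := tri_condition T.
Let P := tri_corner T.

Lemma shape_area i j k : i != j -> j != k -> i != k ->
  area (z i) (z j) (z k) != 0.
Proof. by move=> ij jk ik; apply: noncollinear_area; apply: shape_z.2. Qed.

Lemma third_index (i j : 'I_n) : exists k, i != k /\ j != k.
Proof.
have : (0 < #|~: [set i; j]|)%N.
  by rewrite cardsCs finset.setCK card_ord subn_gt0 (leq_trans _ shape_z.1) //
    ltnS cards2; case: eqP.
case/card_gt0P => k; rewrite !inE negb_or => /andP[]; rewrite !(eq_sym k).
by exists k.
Qed.

Lemma shape_inj : injective z.
Proof.
move=> i j zij; apply/eqP/negPn/negP => neq_ij.
have [k [ik jk]] := third_index i j.
have := shape_area neq_ij jk ik; rewrite zij /area !subrr !mul0r subrr.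
by rewrite eqxx.
Qed.

Lemma drawingsP (rho : V -> 'rV[R[i]]_2) : drawings T rho <->
  forall a b c, a \in C -> b \in C -> c \in C ->
    area (rho a) (rho b) (rho c) = 0.
Proof.
split=> [/collinearP h a b c aC bC cC|h].
  by apply: h; [exists a|exists b|exists c].
by apply/collinearP => _ _ _ [a aC <-] [b bC <-] [c cC <-]; exact: h.
Qed.

(** A map outside the set violates either a vanishing area on [C] or one coordinate of a linear
    equation from [affine_map_frame]; that equation is the separating polynomial. *)
Lemma algebraic_shaped : algebraic_set (shaped_drawings T z).
Proof.
have n_gt0 : (0 < n)%N by rewrite (leq_trans _ shape_z.1).
pose i := Ordinal n_gt0.
have [j [ij _]] := third_index i i; have [k [ik jk]] := third_index i j.
have zD := shape_area ij jk ik.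
pose X := @coordX R[i] V.
apply: algebraic_set_separation => rho nrho.
have [/drawingsP rhoC|] := pselect (drawings T rho); last first.
  move/drawingsP => nC; apply: contrapT => nsep.
  apply: nC => a b c aC bC cC; apply/eqP/negPn/negP => abc; apply: nsep.
  pose p := (X b 0 - X a 0) * (X c 1 - X a 1)
    - (X b 1 - X a 1) * (X c 0 - X a 0).
  have pE tau : meval (coordinates tau) p = area (tau a) (tau b) (tau c).
    by rewrite /p mevalB !mevalM !mevalB !meval_coordX.
  exists p; split=> [tau [/drawingsP tauC _]|]; rewrite pE //.
  exact: tauC.
apply: contrapT => nsep; apply: nrho; split; first exact/drawingsP.
apply/(affine_map_frame (fun m => rho (P m)) zD) => m.
apply/rowP => e; apply/subr0_eq/eqP/negPn/negP => neq; apply: nsep.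
pose p := mpolyC _ (area (z i) (z j) (z k)) * (X (P m) e - X (P i) e)
  - (mpolyC _ (area (z i) (z m) (z k)) * (X (P j) e - X (P i) e)
     + mpolyC _ (area (z i) (z j) (z m)) * (X (P k) e - X (P i) e)).
have pE tau : meval (coordinates tau) p =
    area (z i) (z j) (z k) * (tau (P m) 0 e - tau (P i) 0 e)
  - (area (z i) (z m) (z k) * (tau (P j) 0 e - tau (P i) 0 e)
     + area (z i) (z j) (z m) * (tau (P k) 0 e - tau (P i) 0 e)).
  by rewrite /p mevalB mevalD !mevalM !mevalB !mevalC !meval_coordX.
exists p; split=> [tau [_ tauz]|]; rewrite pE; last by move: neq; rewrite !mxE.
move/(affine_map_frame (fun m => tau (P m)) zD)/(_ m)/rowP/(_ e): tauz.
by rewrite !mxE => ->; rewrite subrr.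
Qed.

Lemma shaped_nonempty : shaped_drawings T z !=set0.
Proof.
exists (fun=> 0); split.
  by apply/drawingsP => *; rewrite /area /=; ring.
by exists (fun=> 0); split=> //; exact: affine_map_cst.
Qed.

Lemma drawings_parametrization (x : V -> 'rV[R[i]]_2) : drawings T x ->
  exists p u (t : V -> R[i]), forall v, v \in C -> x v = p + t v *: u.
Proof.
move=> [_ [[p [u [_ ->]]] xC]]; exists p, u.
have ex v : exists t, v \in C -> x v = p + t *: u.
  have [vC|nvC] := pselect (v \in C); last by exists 0.
  by have [|t _ <-] := xC (x v); [exists v|exists t].
by exists (fun v => sval (cid (ex v))) => v; case: cid.
Qed.

(* If [x = p + t u] and
   [y = p' + t' u'] on C, then
   [(1-s) p + s p' + ((1-s) t + s t') ((1-s) u + s u')] differs from the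
   segment by [- s (1-s) (t - t') (u - u')]. *)
Lemma shaped_curve x y : shaped_drawings T z x -> shaped_drawings T z y ->
  exists (h : V -> R[i]) (d : 'rV[R[i]]_2), forall s,
    shaped_drawings T z
      (fun v => (1 - s) *: x v + s *: y v - (s * (1 - s)) *: (h v *: d)).
Proof.
move=> [xC [f [fA xf]]] [yC [g [gA yg]]].
have [p [u [t xE]]] := drawings_parametrization xC.
have [p' [u' [t' yE]]] := drawings_parametrization yC.
have [Pinj PB _] := tri_corners T.
have PB' i : P i \in boundary_vertices (tri_complex T) by apply/PB; exists i.
have [l [lA lE]] := affine_form_ext (fun v => t v - t' v) Pinj shape_inj PB'
  (tri_cond T).2.
(* At corners [h] follows the affine form [l], to preserve the shape; elsewhere it is the parameter
   difference. The two agree at corners in [C] by [lE]. *)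
pose h v := if [pick i | P i == v] is Some i then l (z i) else t v - t' v.
have hP i : h (P i) = l (z i).
  by rewrite /h; case: pickP => [j /eqP/Pinj ->//|/(_ i)]; rewrite eqxx.
have hC v : v \in C -> h v = t v - t' v.
  by rewrite /h; case: pickP => // i /eqP <- /lE ->.
exists h, (u - u') => s; split.
  apply/drawingsP.
  have E v : v \in C ->
      (1 - s) *: x v + s *: y v - (s * (1 - s)) *: (h v *: (u - u')) =
      ((1 - s) *: p + s *: p')
        + ((1 - s) * t v + s * t' v) *: ((1 - s) *: u + s *: u').
    by move=> vC; rewrite hC // xE // yE //; apply/rowP => e; rewrite !mxE; ring.
  (* The moving direction may vanish for some [s]; [area_line] covers this case too. *)
  by move=> a b c aC bC cC; rewrite !E //; exact: area_line.
exists (fun w => ((1 - s) *: f w + s *: g w)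
  + (- (s * (1 - s))) *: (l w *: (u - u'))); split.
  apply: affine_mapD; first by apply: affine_mapD; exact: affine_mapZ.
  by apply/affine_mapZ/affine_map_scale.
by move=> i; rewrite -/P hP xf yg scaleNr.
Qed.

End ShapedDrawings.

Theorem theorem3 (R : realType) (V : finType) (n : nat)
    (T : triangulation R V n) (z : 'I_n -> 'rV[R[i]]_2) :
  ngon_shape z -> irreducible_variety (shaped_drawings T z).
Proof.
move=> zP; apply: irreducible_curves => [||x y Xx Xy].
- exact: algebraic_shaped.
- exact: shaped_nonempty.
have [h [d hd]] := shaped_curve zP Xx Xy.
(* The curve of [shaped_curve] with ['X] for [s]; its correction vanishes at 0 and 1, so the ends
   are [x] and [y]. *)
exists (fun v j => (1%:P - 'X) * (x v 0 j)%:P + 'X * (y v 0 j)%:P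
  - 'X * (1%:P - 'X) * (h v * d 0 j)%:P); split.
- move=> s; rewrite (_ : (fun v => _) = fun v =>
    (1 - s) *: x v + s *: y v - (s * (1 - s)) *: (h v *: d)) //.
  by apply/funext => v; apply/rowP => j;
    rewrite !mxE !(hornerD, hornerN, hornerM, hornerC, hornerX).
- by move=> v j; rewrite !(hornerD, hornerN, hornerM, hornerC, hornerX); ring.
- by move=> v j; rewrite !(hornerD, hornerN, hornerM, hornerC, hornerX); ring.
Qed.
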